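(* Let $(M,g)$ be a connected smooth semi-Riemannian manifold of dimension $n\ge 3$ with Levi-Civita connection $\nabla$ and Ricci tensor $S$, let $\phi$ be a scalar function on $M$, and let $Z=S+\phi g$. Suppose there are 1-forms $A$, $B$, $D$ on $M$ such that for all vector fields $X,X_1,X_2$ on $M$ $$(\nabla_X Z)(X_1,X_2)+(\nabla_{X_1}Z)(X,X_2)+(\nabla_{X_2}Z)(X_1,X)=A(X)\,Z(X_1,X_2)+B(X_1)\,Z(X,X_2)+D(X_2)\,Z(X_1,X).$$ Then, for all vector fields $X,X_1,X_2$ on $M$, $$(\nabla_X Z)(X_1,X_2)+(\nabla_{X_1}Z)(X,X_2)+(\nabla_{X_2}Z)(X_1,X)=E(X)\,Z(X_1,X_2)+E(X_1)\,Z(X,X_2)+E(X_2)\,Z(X_1,X),$$ where $E=\frac{A+B+D}{3}$.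
   Context: A semi-Riemannian manifold is a smooth manifold with a smooth nondegenerate symmetric $(0,2)$-tensor field $g$ (of constant signature, not necessarily positive definite). The generalized $Z$-tensor is the symmetric $(0,2)$-tensor $Z=S+\phi g$, where $S$ is the Ricci tensor and $\phi$ is an arbitrary (smooth) scalar function on $M$. *)

(* Defs.v *)
From mathcomp Require Import all_boot all_order all_algebra.
From mathcomp Require Import all_classical all_reals all_analysis.

Set Implicit Arguments.
Unset Strict Implicit.
Unset Printing Implicit Defensive.

Import Order.TTheory GRing.Theory Num.Theory.
Import numFieldNormedType.Exports.

Local Open Scope classical_set_scope.
Local Open Scope ring_scope.

Definition iter_derive (R : realType) (V W : normedModType R)
  (vs : seq V) (f : V -> W) : V -> W := foldr (fun v h => 'D_v h) f vs.

(* [f] is C^oo on some neighbourhood of [x]; one neighbourhood serves all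
   orders of differentiation. *)
Definition smooth_near (R : realType) (V W : normedModType R)
  (f : V -> W) (x : V) : Prop :=
  \forall y \near x, forall vs, differentiable (iter_derive vs f) y.

(* The values of [chart_map] outside [chart_dom] and of [chart_inv] outside
   [chart_map @` chart_dom] are irrelevant. *)
Record chart (R : realType) (n : nat) (M : topologicalType) := Chart {
  chart_dom : set M;
  chart_map : M -> 'rV[R]_n;
  chart_inv : 'rV[R]_n -> M;
  chart_dom_open : open chart_dom;
  chart_img_open : open (chart_map @` chart_dom);
  chartK : forall p, chart_dom p -> chart_inv (chart_map p) = p;
  chart_map_continuous : forall p, chart_dom p -> {for p, continuous chart_map};
  chart_inv_continuous : forall y, (chart_map @` chart_dom) y ->
    {for y, continuous chart_inv}
}.

(* [chart_at] selects, at every point, a chart of the atlas around it; this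
   fixes the model 'rV[R]_n of the tangent space at that point. *)
Record smoothManifold (R : realType) (n : nat) := SmoothManifold {
  carrier :> topologicalType;
  manifold_hausdorff : hausdorff_space carrier;
  manifold_second_countable : @second_countable carrier;
  atlas : set (chart R n carrier);
  atlas_compatible : forall c d p, atlas c -> atlas d ->
    chart_dom c p -> chart_dom d p ->
    smooth_near (chart_map d \o chart_inv c) (chart_map c p);
  chart_at : carrier -> chart R n carrier;
  chart_at_atlas : forall p, atlas (chart_at p);
  chart_at_dom : forall p, chart_dom (chart_at p) p
}.

Section Tensors.
Context (R : realType) (n : nat) (M : smoothManifold R n).
Implicit Types (p q : M) (f : M -> R).

(* A tangent vector at [p] is the row of its components in the basis of
   T_pM given by the coordinates of [chart_at p].  Hence a 1-form has
   as value at [p] a column, and a (0,2)-tensor field a square matrix. *)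
Definition vfield := M -> 'rV[R]_n.
Definition form1 := M -> 'cV[R]_n.
Definition tensor2 := M -> 'M[R]_n.

Implicit Types (X Y W : vfield) (A : form1) (T : tensor2).

Definition app1 A X : M -> R := fun p => (X p *m A p) 0 0.
Definition app2 T X Y : M -> R := fun p => (X p *m T p *m (Y p)^T) 0 0.

(* Matrix, acting on rows from the right, of the change of basis of T_qM from
   the coordinates at [p] to the coordinates at [p']. *)
Definition tangent_change p p' q : 'M[R]_n :=
  'J (chart_map (chart_at p') \o chart_inv (chart_at p))
     (chart_map (chart_at p) q).

Definition fun_in_chart p f : 'rV[R]_n -> R := f \o chart_inv (chart_at p).

Definition vfield_in_chart p X : 'rV[R]_n -> 'rV[R]_n :=
  (fun q => X q *m tangent_change q p q) \o chart_inv (chart_at p).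

(* "At [p]" means: on a neighbourhood of [p]. *)
Definition smooth_fun_at p f : Prop :=
  smooth_near (fun_in_chart p f) (chart_map (chart_at p) p).

Definition smooth_vfield_at p X : Prop :=
  smooth_near (vfield_in_chart p X) (chart_map (chart_at p) p).

Definition smooth_fun f : Prop := forall p, smooth_fun_at p f.

Definition smooth_vfield X : Prop := forall p, smooth_vfield_at p X.

Definition smooth_form1 A : Prop :=
  forall p X, smooth_vfield_at p X -> smooth_fun_at p (app1 A X).

Definition smooth_tensor2 T : Prop :=
  forall p X Y, smooth_vfield_at p X -> smooth_vfield_at p Y ->
    smooth_fun_at p (app2 T X Y).

Definition dact X f : M -> R :=
  fun p => 'D_(X p) (fun_in_chart p f) (chart_map (chart_at p) p).

(* [X, Y]^k = X^i d_i Y^k - Y^i d_i X^k, in the coordinates at the point. *)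
Definition lie_bracket X Y : vfield := fun p =>
  'D_(X p) (vfield_in_chart p Y) (chart_map (chart_at p) p)
  - 'D_(Y p) (vfield_in_chart p X) (chart_map (chart_at p) p).

(* The existentially quantified matrix lists the vectors of
   an orthonormal basis of T_pM, [r] of which are timelike. *)
Record semi_riemannian (g : tensor2) : Prop := SemiRiemannian {
  sr_smooth : smooth_tensor2 g;
  sr_sym : forall p, (g p)^T = g p;
  sr_nondegenerate : forall p (u : 'rV[R]_n),
    (forall v : 'rV[R]_n, (u *m g p *m v^T) 0 0 = 0) -> u = 0;
  sr_signature : exists r : nat, forall p,
    exists2 P : 'M[R]_n, P \in unitmx &
      P *m g p *m P^T = diag_mx (\row_(i < n) if (i < r)%N then -1 else 1)
}.

(* Koszul's axioms, imposed at each point on the fields that are smooth near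
   that point, i.e. on local sections.  A connection on global fields
   extends uniquely to these. *)
Record affine_connection (nabla : vfield -> vfield -> vfield) : Prop :=
  AffineConnection {
  nabla_smooth : forall p X Y, smooth_vfield_at p X -> smooth_vfield_at p Y ->
    smooth_vfield_at p (nabla X Y);
  nablaDl : forall p X X' Y, smooth_vfield_at p X -> smooth_vfield_at p X' ->
    smooth_vfield_at p Y ->
    nabla (fun q => X q + X' q) Y p = nabla X Y p + nabla X' Y p;
  nablaZl : forall p f X Y, smooth_fun_at p f -> smooth_vfield_at p X ->
    smooth_vfield_at p Y ->
    nabla (fun q => f q *: X q) Y p = f p *: nabla X Y p;
  nablaDr : forall p X Y Y', smooth_vfield_at p X -> smooth_vfield_at p Y ->
    smooth_vfield_at p Y' ->
    nabla X (fun q => Y q + Y' q) p = nabla X Y p + nabla X Y' p;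
  nabla_leibniz : forall p f X Y, smooth_fun_at p f -> smooth_vfield_at p X ->
    smooth_vfield_at p Y ->
    nabla X (fun q => f q *: Y q) p = dact X f p *: Y p + f p *: nabla X Y p
}.

Record levi_civita (g : tensor2) (nabla : vfield -> vfield -> vfield) : Prop :=
  LeviCivita {
  lc_connection : affine_connection nabla;
  lc_torsion_free : forall p X Y, smooth_vfield_at p X ->
    smooth_vfield_at p Y ->
    nabla X Y p - nabla Y X p = lie_bracket X Y p;
  lc_metric : forall p X Y W, smooth_vfield_at p X -> smooth_vfield_at p Y ->
    smooth_vfield_at p W ->
    dact X (app2 g Y W) p = app2 g (nabla X Y) W p + app2 g Y (nabla X W) p
}.

Section Connection.
Variable nabla : vfield -> vfield -> vfield.

Definition curvature X Y W : vfield := fun p =>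
  nabla X (nabla Y W) p - nabla Y (nabla X W) p - nabla (lie_bracket X Y) W p.

(* The [i]-th coordinate field of [chart_at p], on the domain of that chart. *)
Definition coord_field p (i : 'I_n) : vfield :=
  fun q => delta_mx 0 i *m tangent_change p q q.

(* S_p(y, w) is the trace of the endomorphism v |-> R(v, y) w of T_pM.
   As R is a tensor, the vectors of the basis of T_pM may be extended to
   vector fields near [p] in any way: coordinate fields are used here. *)
Definition ricci : tensor2 := fun p =>
  \matrix_(j, k) \tr (\matrix_(i < n)
    curvature (coord_field p i) (coord_field p j) (coord_field p k) p).

(* (nabla_X T)(Y, W) *)
Definition nabla_tensor2 T X Y W : M -> R := fun p =>
  dact X (app2 T Y W) p - app2 T (nabla X Y) W p - app2 T Y (nabla X W) p.

End Connection.

Definition Ztensor (g : tensor2) (nabla : vfield -> vfield -> vfield)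
  (phi : M -> R) : tensor2 := fun p => ricci nabla p + phi p *: g p.

End Tensors.

(* Main.v *)
Require Import Defs.
From mathcomp Require Import all_boot all_order all_algebra.
From mathcomp Require Import all_classical all_reals all_analysis.
From mathcomp Require Import ring lra.
Import Order.TTheory GRing.Theory Num.Theory.
Import numFieldNormedType.Exports.
Local Open Scope classical_set_scope.
Local Open Scope ring_scope.

Set Implicit Arguments.
Unset Strict Implicit.
Unset Printing Implicit Defensive.

(** If Z is a symmetric tensor, the cyclic sum on the left-hand side is
    unchanged when (X, X1, X2) is permuted cyclically.  Writing the hypothesis
    for the three cyclic permutations of the arguments and adding the results,
    the coefficient of Z(X1, X2) on the right becomes A(X) + B(X) + D(X), and
    likewise for the two other terms; dividing by 3 gives the claim.

    As g is symmetric, everything rests on the symmetry of the Ricci tensor of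
    a Levi-Civita connection ([ricci_sym]).  In a coordinate frame d_i at p,
    the first Bianchi identity ([first_bianchi]) gives
      R(d_i, d_j) d_k - R(d_i, d_k) d_j = - R(d_j, d_k) d_i,
    so that, taking the trace over i, S_jk - S_kj is minus the trace of the
    endomorphism R(d_j, d_k).  That endomorphism is skew for g
    ([curvature_skew]), and hence has trace 0 ([trace_skew]).

    These identities involve covariant derivatives of covariant derivatives,
    so metricity and torsion-freeness are needed at all points near p,
    although the frame d_i is tied to the chart selected at p while each point
    q has a chart of its own.  Hence the preliminary parts: compositions of
    smooth maps are smooth ([smooth_near_comp]), which makes the frame smooth
    at every such q ([coord_field_smooth]); directional derivatives commute
    ([derive_comm]), which makes the brackets of the frame vanish
    ([lie_bracket_coord_field]) and its actions on functions commute
    ([dact_coord_comm]); and a connection is local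
    ([nabla_near_r], [nabla_near_l]), so that identities valid near p can be
    differentiated covariantly at p. *)

(** * Differentiability on neighbourhoods *)

Section DerivativesNear.
Context (R : realType) (V W : normedModType R).
Implicit Types (f h : V -> W) (U : set V).

(** The differential of f is a linear approximation of h as well, and uniqueness
    of the differential identifies it with that of h. *)
Lemma differentiable_near f h x :
  {near x, f =1 h} -> differentiable f x -> differentiable h x.
Proof.
move=> fh /diff_locallyP[cdf fE].
have fhx : f x = h x := nbhs_singleton fh.
have hE : h \o shift x = cst (h x) + 'd f x +o_ 0 id.
  apply/eqaddoP => _/posnumP[e]; rewrite -fhx.
  have /eqaddoP/(_ _ (gt0 e)) := fE.
  apply: filter_app.
  have : \forall y \near (0 : V), f (y + x) = h (y + x).
    by move: fh; rewrite (near_shift 0) /= subr0.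
  by apply: filterS => y /= fhy; rewrite !fctE /= fhy.
have dE := diff_unique cdf hE.
by apply/diff_locallyP; rewrite dE.
Qed.

Lemma derive_comp (n : nat) (f : V -> 'rV[R]_n) (h : 'rV[R]_n -> W) x v :
  differentiable f x -> differentiable h (f x) ->
  'D_v (h \o f) x = 'D_('D_v f x) h (f x).
Proof.
move=> df dh; rewrite !deriveE //; last exact: differentiable_comp.
by rewrite diff_comp.
Qed.

End DerivativesNear.

Section Coordinates.
Context (R : realType) (V : normedModType R) (n : nat).

Lemma differentiable_entry (f : V -> 'rV[R]_n) i x :
  differentiable f x -> differentiable (fun y => f y 0 i) x.
Proof.
move=> df.
exact: (@differentiable_comp _ _ _ _ f (fun N : 'rV[R]_n => N 0 i) x df
  (differentiable_coord _ _ _)).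
Qed.

Lemma differentiable_entries (f : V -> 'rV[R]_n) x :
  (forall i, differentiable (fun y => f y 0 i) x) -> differentiable f x.
Proof.
move=> df.
rewrite (_ : f = \sum_(i < n) (fun y => f y 0 i *: (delta_mx 0 i : 'rV[R]_n))).
  by apply: differentiable_sum => i; apply: differentiableZl.
by apply/funext => y; rewrite fct_sumE [LHS]row_sum_delta.
Qed.

Lemma derive_entry (f : V -> 'rV[R]_n) i x v :
  differentiable f x -> 'D_v (fun y => f y 0 i) x = ('D_v f x) 0 i.
Proof. by move=> df; rewrite derive_mx ?mxE //; apply: diff_derivable. Qed.

Lemma derive_sum_coord (W : normedModType R) (h : 'rV[R]_n -> W) y w :
  differentiable h y -> 'D_w h y = \sum_(i < n) w 0 i *: 'D_(delta_mx 0 i) h y.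
Proof.
move=> dh; rewrite [in LHS](row_sum_delta w) deriveE // linear_sum.
by apply: eq_bigr => i _; rewrite linearZ deriveE.
Qed.

End Coordinates.

(** * Smooth maps and their compositions *)

Section Ck.
Context (R : realType).

(** The derivative is taken innermost, whereas [iter_derive] takes it outermost:
    with this nesting the product and chain rules allow induction on [k]. *)
Fixpoint diff_upto (V W : normedModType R) (k : nat) (U : set V) (f : V -> W)
  : Prop :=
  (forall y, U y -> differentiable f y) /\
  if k is k'.+1 then forall v, diff_upto k' U ('D_v f) else True.

Section Basic.
Context (V W : normedModType R) (U : set V).
Implicit Types (f h : V -> W).

Lemma diff_upto_differentiable k f y :
  diff_upto k U f -> U y -> differentiable f y.
Proof. by case: k => [|k] [df _]; apply: df. Qed.

Lemma diff_uptoW k f : diff_upto k.+1 U f -> diff_upto k U f.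
Proof.
elim: k f => [|k IH] f [df ddf]; first by [].
by split=> // v; apply: IH.
Qed.

Lemma diff_upto_sub (U' : set V) k f :
  U' `<=` U -> diff_upto k U f -> diff_upto k U' f.
Proof.
move=> sU; elim: k f => [|k IH] f [df ddf]; split=> //.
- by move=> y /sU; apply: df.
- by move=> y /sU; apply: df.
by move=> v; apply: IH (ddf v).
Qed.

Context (oU : open U).

Lemma near_open f h : {in U, f =1 h} -> forall y, U y -> {near y, f =1 h}.
Proof.
move=> fh y Uy; have := open_nbhs_nbhs (conj oU Uy).
by apply: filterS => z Uz; apply: fh; rewrite inE.
Qed.

Lemma diff_upto_eq k f h :
  {in U, f =1 h} -> diff_upto k U f -> diff_upto k U h.
Proof.
elim: k f h => [|k IH] f h fh [df ddf]; split=> //.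
- by move=> y Uy; apply: differentiable_near (near_open fh Uy) (df y Uy).
- by move=> y Uy; apply: differentiable_near (near_open fh Uy) (df y Uy).
move=> v; apply: IH (ddf v) => y; rewrite inE => Uy.
exact/near_eq_derive/near_open.
Qed.

Lemma diff_upto_cst k (c : W) : diff_upto k U (cst c : V -> W).
Proof.
elim: k c => [|k IH] c; split=> //.
by move=> v; rewrite (_ : 'D_v _ = cst 0) //; apply/funext=> y; apply: derive_cst.
Qed.

Lemma diff_uptoD k f h :
  diff_upto k U f -> diff_upto k U h -> diff_upto k U (f + h).
Proof.
elim: k f h => [|k IH] f h [df ddf] [dh ddh]; split=> //.
- by move=> y Uy; apply: differentiableD; [exact: df|exact: dh].
- by move=> y Uy; apply: differentiableD; [exact: df|exact: dh].
move=> v; apply: (@diff_upto_eq _ ('D_v f + 'D_v h)); last exact: IH (ddf v) (ddh v).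
move=> y; rewrite inE => Uy.
by rewrite deriveD //; apply: diff_derivable; [exact: df|exact: dh].
Qed.

Lemma diff_upto_sum k m (F : 'I_m -> V -> W) :
  (forall i, diff_upto k U (F i)) -> diff_upto k U (\sum_(i < m) F i).
Proof.
move=> dF; elim/big_ind: _ => //; [exact: diff_upto_cst | exact: diff_uptoD].
Qed.

End Basic.

Lemma diff_uptoM (V : normedModType R) (U : set V) k (f h : V -> R) :
  open U -> diff_upto k U f -> diff_upto k U h -> diff_upto k U (f * h).
Proof.
move=> oU; elim: k f h => [|k IH] f h df dh.
  by split=> // y Uy; case: df => df _; case: dh => dh _;
    apply: differentiableM; [exact: df|exact: dh].
split.
  move=> y Uy; apply: differentiableM;
    [exact: diff_upto_differentiable df Uy|exact: diff_upto_differentiable dh Uy].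
move=> v; apply: (@diff_upto_eq _ _ _ oU _ (f * 'D_v h + h * 'D_v f)).
  move=> y; rewrite inE => Uy.
  by rewrite deriveM //; apply: diff_derivable;
    [exact: diff_upto_differentiable df Uy|exact: diff_upto_differentiable dh Uy].
have [_ ddf] := df; have [_ ddh] := dh.
by apply: diff_uptoD => //; apply: IH => //; [exact: diff_uptoW|exact: ddh
  |exact: diff_uptoW|exact: ddf].
Qed.

Lemma diff_upto_entry (V : normedModType R) (U : set V) k n (f : V -> 'rV[R]_n) i :
  open U -> diff_upto k U f -> diff_upto k U (fun y => f y 0 i).
Proof.
move=> oU; elim: k f => [|k IH] f [df ddf]; split=> //.
- by move=> y Uy; apply/differentiable_entry/df.
- by move=> y Uy; apply/differentiable_entry/df.
move=> v; apply: (@diff_upto_eq _ _ _ oU _ (fun y => ('D_v f y) 0 i));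
  last exact: IH (ddf v).
by move=> y; rewrite inE => Uy; rewrite derive_entry //; apply: df.
Qed.

Lemma diff_upto_entries (V : normedModType R) (U : set V) k n (f : V -> 'rV[R]_n) :
  open U -> (forall i, diff_upto k U (fun y => f y 0 i)) -> diff_upto k U f.
Proof.
move=> oU; elim: k f => [|k IH] f df.
  by split=> // y Uy; apply: differentiable_entries => i; case: (df i) => + _; apply.
have df0 y : U y -> differentiable f y.
  move=> Uy; apply: differentiable_entries => i.
  exact: diff_upto_differentiable (df i) Uy.
split=> // v; apply: IH => i; have [_ /(_ v)] := df i.
by apply: diff_upto_eq => // y; rewrite inE => Uy; rewrite derive_entry //; apply: df0.
Qed.

(** By the chain rule, D_v (h o f) is the sum over i of (D_v f)_i times
    (D_i h) o f; each factor is one step less differentiable than f and h, so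
    induction on the order applies. *)
Lemma diff_upto_comp (V : normedModType R) (U : set V) n (U' : set 'rV[R]_n)
    k (f : V -> 'rV[R]_n) (h : 'rV[R]_n -> R) :
  open U -> U `<=` f @^-1` U' ->
  diff_upto k U f -> diff_upto k U' h -> diff_upto k U (h \o f).
Proof.
move=> oU fU; elim: k h => [|k IH] h df dh; split=> //.
- by move=> y Uy; apply: differentiable_comp; [apply: (df.1)|apply: (dh.1); apply: fU].
- by move=> y Uy; apply: differentiable_comp; [apply: (df.1)|apply: (dh.1); apply: fU].
move=> v; have [df1 ddf] := df; have [dh1 ddh] := dh.
apply: (@diff_upto_eq _ _ _ oU _
  (\sum_(i < n) (fun y => ('D_v f y) 0 i) * ('D_(delta_mx 0 i) h \o f))).
  move=> y; rewrite inE => Uy; rewrite derive_comp; [|exact: df1|exact/dh1/fU].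
  rewrite derive_sum_coord; last exact/dh1/fU.
  by rewrite fct_sumE; apply: eq_bigr.
apply: diff_upto_sum => // i; apply: diff_uptoM => //.
  by apply: diff_upto_entry => //; exact: ddf.
by apply: IH; [exact: diff_uptoW|exact: ddh].
Qed.

Section SmoothNear.
Context (V W : normedModType R).
Implicit Types (f h : V -> W) (x : V).

(** Taking one order of differentiation at a time, on a fixed set, is what makes
    smoothness of products and compositions provable by induction. *)
Lemma diff_upto_iter U f :
  (forall k, diff_upto k U f) <->
  (forall y, U y -> forall vs, differentiable (iter_derive vs f) y).
Proof.
split=> [df y Uy vs|].
  elim/last_ind: vs f df => [|vs v IH] f df; first by case: (df 0) => + _; apply.
  rewrite /iter_derive foldr_rcons; apply: IH => k.
  by have [_ ddf] := df k.+1; apply: ddf.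
move=> df k; elim: k f df => [|k IH] f df; split=> //.
- by move=> y Uy; apply: (df y Uy [::]).
- by move=> y Uy; apply: (df y Uy [::]).
move=> v; apply: IH => y Uy vs.
by have := df y Uy (rcons vs v); rewrite /iter_derive foldr_rcons.
Qed.

Lemma smooth_nearP f x :
  smooth_near f x <->
  exists2 U, open_nbhs x U & forall k, diff_upto k U f.
Proof.
split=> [sf|[U xU /diff_upto_iter df]].
  have : nbhs x [set y | forall vs, differentiable (iter_derive vs f) y] by [].
  by rewrite nbhsE => -[U xU df]; exists U => //; apply/diff_upto_iter.
suff : nbhs x [set y | forall vs, differentiable (iter_derive vs f) y] by [].
by rewrite nbhsE; exists U.
Qed.

Lemma smooth_near_eq f h x : {near x, f =1 h} -> smooth_near f x -> smooth_near h x.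
Proof.
rewrite /prop_near1 nbhsE => -[U' [oU' U'x] fh] /smooth_nearP[U [oU Ux] df].
apply/smooth_nearP; exists (U `&` U').
  by split; [exact: openI|].
move=> k; apply: (@diff_upto_eq _ _ _ _ _ f).
- exact: openI.
- by move=> y; rewrite inE => -[_ /fh].
- by apply: diff_upto_sub (df k) => y [].
Qed.

Lemma smooth_near_cst (c : W) x : smooth_near (cst c) x.
Proof.
by apply/smooth_nearP; exists setT; [exact: open_nbhsT|move=> k; apply: diff_upto_cst].
Qed.

Lemma smooth_near_differentiable f x : smooth_near f x -> differentiable f x.
Proof. by move=> /nbhs_singleton /(_ [::]). Qed.

Lemma smooth_near_derive f x v : smooth_near f x -> smooth_near ('D_v f) x.
Proof.
apply: filterS => y df vs; have := df (rcons vs v).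
by rewrite /iter_derive foldr_rcons.
Qed.

Lemma smooth_near_near f x :
  smooth_near f x -> \forall y \near x, smooth_near f y.
Proof. exact: near_join. Qed.

End SmoothNear.

Lemma smooth_near_entry (V : normedModType R) n (f : V -> 'rV[R]_n) i x :
  smooth_near f x -> smooth_near (fun y => f y 0 i) x.
Proof.
move=> /smooth_nearP[U xU df]; apply/smooth_nearP; exists U => // k.
by apply: diff_upto_entry => //; case: xU.
Qed.

Lemma smooth_near_comp (V : normedModType R) n m
    (f : V -> 'rV[R]_n) (h : 'rV[R]_n -> 'rV[R]_m) x :
  smooth_near f x -> smooth_near h (f x) -> smooth_near (h \o f) x.
Proof.
move=> sf /smooth_nearP[U' [oU' U'x] dh].
have cf : \forall y \near x, U' (f y).
  have /differentiable_continuous := smooth_near_differentiable sf.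
  by apply; apply: open_nbhs_nbhs; split.
move: sf cf => /smooth_nearP[U [oU Ux] df].
rewrite /prop_near1 nbhsE => -[U1 [oU1 U1x] fU1].
apply/smooth_nearP; exists (U `&` U1); first by split; [exact: openI|].
move=> k; apply: diff_upto_entries => [|i]; first exact: openI.
apply: (@diff_upto_comp _ _ _ U' _ f (fun z => h z 0 i)).
- exact: openI.
- by move=> y [_ /fU1].
- by apply: diff_upto_sub (df k) => y [].
- exact: diff_upto_entry.
Qed.

End Ck.

(** * Symmetry of second derivatives *)

Section Schwarz.
Context (R : realType) (V : normedModType R).
Implicit Types (F : V -> R) (x u v w : V).

Lemma is_derive_line F x w (s : R) :
  differentiable F (x + s *: w) ->
  is_derive s (1 : R) (fun s : R => F (x + s *: w)) ('D_w F (x + s *: w)).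
Proof.
move=> dF.
have dl : is_diff s (fun s : R => x + s *: w) (fun r => r *: w).
  have d1 : is_diff s (cst x : R -> V) 0 by apply: is_diff_cst.
  have d2 : is_diff s ( *:%R^~ w : R -> V) ( *:%R^~ w) by apply: is_diff_scalel.
  have := is_diffD d1 d2; rewrite add0r; exact.
have dFl : differentiable (F \o (fun s : R => x + s *: w)) s.
  exact: differentiable_comp.
apply: DeriveDef; first exact: diff_derivable.
rewrite deriveE // (@diff_comp _ _ _ _ (fun s : R => x + s *: w)) //= diff_val.
by rewrite scale1r deriveE.
Qed.

Lemma mean_value_segment F x w (h : R) : 0 < h ->
  (forall s, 0 <= s <= h -> differentiable F (x + s *: w)) ->
  exists2 s, 0 <= s <= h & F (x + h *: w) - F x = 'D_w F (x + s *: w) * h.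
Proof.
move=> h0 dF; pose G (s : R) := F (x + s *: w).
have dG s : s \in `[0, h]%R -> is_derive s (1 : R) G ('D_w F (x + s *: w)).
  by rewrite in_itv => sh; apply/is_derive_line/dF.
have dGo s : s \in `]0, h[%R -> is_derive s (1 : R) G ('D_w F (x + s *: w)).
  by rewrite in_itv /= => /andP[s0 sh]; apply: dG; rewrite in_itv /= !ltW.
have cG : {within `[0, h], continuous G}.
  apply: derivable_within_continuous => s sh.
  by have dGs := dG s sh; exact: ex_derive.
have [s] := MVT h0 dGo cG.
rewrite in_itv /= => /andP[s0 sh]; rewrite /G scale0r addr0 subr0 => ->.
by exists s => //; rewrite !ltW.
Qed.

(** The left-hand side is the increment over h u of y |-> F (y + h v) - F y;
    two applications of the mean value theorem turn it into a second
    derivative.  It is symmetric in u and v. *)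
Lemma second_difference F x u v (h : R) : 0 < h ->
  (forall s t, 0 <= s <= h -> 0 <= t <= h ->
    differentiable F (x + s *: u + t *: v) /\
    differentiable ('D_u F) (x + s *: u + t *: v)) ->
  exists s t, [/\ 0 <= s <= h, 0 <= t <= h &
    F (x + h *: u + h *: v) - F (x + h *: u) - F (x + h *: v) + F x
    = 'D_v ('D_u F) (x + s *: u + t *: v) * h * h].
Proof.
move=> h0 dF.
have h1 : 0 <= (0 : R) <= h by rewrite lexx ltW.
have h2 : 0 <= h <= h by rewrite lexx ltW.
pose G y := F (y + h *: v) - F y.
have shG y : differentiable F (y + h *: v) -> differentiable F y ->
    is_diff y G (('d F (y + h *: v) : V -> R) - ('d F y : V -> R)).
  move=> d1 d2.
  have ds : is_diff y (fun y => y + h *: v) id.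
    have e1 : is_diff y (id : V -> V) id by apply: is_diff_id.
    have e2 : is_diff y (cst (h *: v) : V -> V) 0 by apply: is_diff_cst.
    have := is_diffD e1 e2; rewrite addr0; exact.
  have d1' := differentiableP d1. have d2' := differentiableP d2.
  have := @is_diff_comp _ _ _ _ (fun y => y + h *: v) _ F _ y ds d1'.
  by move=> d3; exact: is_diffB d3 d2'.
have dF0 s : 0 <= s <= h -> differentiable F (x + s *: u).
  by move=> sh; have [] := dF s 0 sh h1; rewrite scale0r addr0.
have dG s : 0 <= s <= h -> differentiable G (x + s *: u).
  move=> sh; have d := shG (x + s *: u) (dF s h sh h2).1 (dF0 s sh).
  exact: ex_diff.
have [s sh Gs] := mean_value_segment h0 dG.
have dDF t : 0 <= t <= h -> differentiable ('D_u F) (x + s *: u + t *: v).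
  by move=> th; have [] := dF s t sh th.
have [t th Ft] := mean_value_segment h0 dDF.
exists s, t; split => //; rewrite -Ft.
transitivity (G (x + h *: u) - G x); first by rewrite /G; ring.
rewrite Gs; congr (_ * _); rewrite deriveE; last exact: dG.
have d := shG (x + s *: u) (dF s h sh h2).1 (dF0 s sh).
by rewrite diff_val !deriveE //; [exact: dF0|exact: (dF s h sh h2).1].
Qed.

Lemma near_parallelogram x u v (P : set V) : nbhs x P ->
  exists2 h : R, 0 < h & forall s t, 0 <= s <= h -> 0 <= t <= h ->
    P (x + s *: u + t *: v).
Proof.
move=> /nbhs_ballP[e /= e0 eP].
(* The summand 1 keeps c positive when u = v = 0. *)
pose c := `|u| + `|v| + 1.
have c0 : 0 < c by rewrite /c ltr_wpDl ?addr_ge0.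
exists (e / 2 / c); first by rewrite !divr_gt0.
move=> s t /andP[s0 sh] /andP[t0 th]; apply: eP.
rewrite -ball_normE /ball_ /= -addrA opprD addrA subrr sub0r normrN.
apply: (le_lt_trans (ler_normD _ _)); rewrite !normrZ !ger0_norm //.
apply: (@le_lt_trans _ _ (e / 2 / c * c)).
  have : s * `|u| + t * `|v| <= e / 2 / c * `|u| + e / 2 / c * `|v|.
    by apply: lerD; apply: ler_wpM2r.
  have : 0 <= e / 2 / c by rewrite !divr_ge0 // ltW.
  by rewrite /c !mulrDr mulr1; lra.
by rewrite mulfVK ?gt_eqF //; lra.
Qed.

(** The symmetric second difference over a small parallelogram equals h^2 times
    D_v D_u F at some point of it, and h^2 times D_u D_v F at some other point;
    both derivatives are continuous at x. *)
Theorem derive_comm F x u v :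
  smooth_near F x -> 'D_u ('D_v F) x = 'D_v ('D_u F) x.
Proof.
move=> sF; apply/eqP; rewrite -subr_eq0 -normr_le0; apply/ler_addgt0Pl => e e0.
rewrite addr0.
have cvg2 a b : \forall y \near x, `|'D_a ('D_b F) x - 'D_a ('D_b F) y| < e / 2.
  have /smooth_near_differentiable/differentiable_continuous :=
    smooth_near_derive a (smooth_near_derive b sF).
  by move=> /cvgrPdist_lt; apply; rewrite divr_gt0.
have : \forall y \near x, [/\ smooth_near F y,
     `|'D_u ('D_v F) x - 'D_u ('D_v F) y| < e / 2 &
     `|'D_v ('D_u F) x - 'D_v ('D_u F) y| < e / 2].
  by apply: filterS3 (smooth_near_near sF) (cvg2 u v) (cvg2 v u) => y.
move=> /(near_parallelogram u v)[h h0 hP].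
have dP a s t : 0 <= s <= h -> 0 <= t <= h ->
    differentiable F (x + s *: u + t *: v) /\
    differentiable ('D_a F) (x + s *: u + t *: v).
  move=> sh th; have [sy _ _] := hP s t sh th; split.
    exact: smooth_near_differentiable.
  exact/smooth_near_differentiable/smooth_near_derive.
have [s [t [sh th E1]]] := second_difference h0 (dP u).
have dP' a s' t' : 0 <= s' <= h -> 0 <= t' <= h ->
    differentiable F (x + s' *: v + t' *: u) /\
    differentiable ('D_a F) (x + s' *: v + t' *: u).
  by move=> s'h t'h; rewrite addrAC; apply: dP.
have [t' [s' [t'h s'h E2]]] := second_difference h0 (dP' v).
have [_ _ B1] := hP s t sh th.
have [_ B2 _] := hP s' t' s'h t'h.
move: E2; rewrite (addrAC x (h *: v)) (addrAC x (t' *: v)) => E2.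
have cancel (a b c d p q : R) : a - b - c + d = p * h * h ->
    a - c - b + d = q * h * h -> p = q.
  move=> pE qE; have hh : h * h != 0 by rewrite mulf_neq0 ?gt_eqF.
  by apply: (mulIf hh); rewrite !mulrA -pE -qE; ring.
have close (p q r : R) : `|p - r| < e / 2 -> `|q - r| < e / 2 -> `|p - q| <= e.
  move=> pr qr; rewrite (splitr e) -(subrKA r).
  by apply: (le_trans (ler_normD _ _)); rewrite lerD // ltW // distrC.
rewrite (cancel _ _ _ _ _ _ E1 E2) in B1.
exact: close B2 B1.
Qed.

End Schwarz.

Theorem derive_comm_rV (R : realType) (V : normedModType R) n (F : V -> 'rV[R]_n) x u v :
  smooth_near F x -> 'D_u ('D_v F) x = 'D_v ('D_u F) x.
Proof.
move=> sF; apply/rowP => i.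
have H a b : ('D_a ('D_b F) x) 0 i = 'D_a ('D_b (fun y => F y 0 i)) x.
  rewrite -derive_entry; last exact/smooth_near_differentiable/smooth_near_derive.
  apply: near_eq_derive; have := smooth_near_near sF.
  by apply: filterS => y sy; rewrite derive_entry //; apply: smooth_near_differentiable.
have E := derive_comm u v (smooth_near_entry i sF).
exact: (etrans (H u v) (etrans E (esym (H v u)))).
Qed.

(** * Charts and changes of coordinates *)

Section ChartNeighborhoods.
Context (R : realType) (n : nat) (M : topologicalType).
Implicit Types (c d : chart R n M) (q : M).

Lemma near_chart_inv c q (P : set M) : chart_dom c q ->
  (\forall r \near q, P r) -> \forall y \near chart_map c q, P (chart_inv c y).
Proof.
move=> cq; rewrite -{1}(chartK cq).
by have := @chart_inv_continuous _ _ _ c _ (imageP (chart_map c) cq); apply.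
Qed.

Lemma near_chart_dom c q : chart_dom c q -> \forall r \near q, chart_dom c r.
Proof.
by move=> cq; apply: open_nbhs_nbhs; split=> //; apply: chart_dom_open.
Qed.

Lemma near_chart_invK c q : chart_dom c q ->
  \forall y \near chart_map c q, chart_map c (chart_inv c y) = y.
Proof.
move=> cq.
have := open_nbhs_nbhs (conj (@chart_img_open _ _ _ c) (imageP (chart_map c) cq)).
by apply: filterS => _ [r cr <-]; rewrite chartK.
Qed.

Definition transition c d : 'rV[R]_n -> 'rV[R]_n := chart_map d \o chart_inv c.

Lemma transitionE c d q :
  chart_dom c q -> transition c d (chart_map c q) = chart_map d q.
Proof. by move=> cq; rewrite /transition /= chartK. Qed.

Lemma near_transition_comp c d q (T : Type) (f : M -> T) :
  chart_dom c q -> chart_dom d q ->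
  {near chart_map c q, f \o chart_inv c =1 (f \o chart_inv d) \o transition c d}.
Proof.
move=> cq dq; apply: filterS (near_chart_inv cq (near_chart_dom dq)) => y dy.
by rewrite /= chartK.
Qed.

End ChartNeighborhoods.

Section Atlas.
Context (R : realType) (n : nat) (M : smoothManifold R n).
Implicit Types (c d e : chart R n M) (p q : M).

Lemma transition_smooth c d q : atlas c -> atlas d ->
  chart_dom c q -> chart_dom d q -> smooth_near (transition c d) (chart_map c q).
Proof. exact: atlas_compatible. Qed.

Lemma transition_jacobian c d q v : atlas c -> atlas d ->
  chart_dom c q -> chart_dom d q ->
  v *m 'J (transition c d) (chart_map c q) = 'D_v (transition c d) (chart_map c q).
Proof.
move=> ac ad cq dq; rewrite deriveEjacobian //.
exact/smooth_near_differentiable/transition_smooth.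
Qed.

Lemma jacobian_cocycle c d e q : atlas c -> atlas d -> atlas e ->
  chart_dom c q -> chart_dom d q -> chart_dom e q ->
  'J (transition c d) (chart_map c q) *m 'J (transition d e) (chart_map d q)
  = 'J (transition c e) (chart_map c q).
Proof.
move=> ac ad ae cq dq eq; apply/row_matrixP => i; rewrite !rowE mulmxA.
have Ecd v := transition_jacobian v ac ad cq dq.
have Ede v := transition_jacobian v ad ae dq eq.
have Ece v := transition_jacobian v ac ae cq eq.
(* The Jacobians are made opaque to keep unification from unfolding them. *)
move: Ecd Ede Ece.
generalize ('J (transition c d) (chart_map c q)) => Jcd.
generalize ('J (transition d e) (chart_map d q)) => Jde.
generalize ('J (transition c e) (chart_map c q)) => Jce Ecd Ede Ece.
rewrite Ecd Ede Ece.
have scd := smooth_near_differentiable (transition_smooth ac ad cq dq).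
have := smooth_near_differentiable (transition_smooth ad ae dq eq).
rewrite -(transitionE d cq) => sde.
rewrite -derive_comp //; apply: near_eq_derive.
by near do apply/esym; apply: near_transition_comp.
Unshelve. all: by end_near. Qed.

Lemma jacobian_transition_id c q : atlas c -> chart_dom c q ->
  'J (transition c c) (chart_map c q) = 1%:M.
Proof.
move=> ac cq; apply/row_matrixP => i; rewrite !rowE mulmx1.
rewrite (transition_jacobian _ ac ac cq cq).
rewrite (near_eq_derive _ (near_chart_invK cq)); exact: derive_id.
Qed.

Notation ephi p := (chart_map (chart_at p)).
Notation dom p := (chart_dom (chart_at p)).

Lemma coord_fieldE p i : coord_field p i p = delta_mx 0 i.
Proof.
rewrite /coord_field /tangent_change jacobian_transition_id ?mulmx1 //.
  exact: chart_at_atlas.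
exact: chart_at_dom.
Qed.

Lemma coord_field_change p s i q : dom p q -> dom s q ->
  coord_field p i q *m tangent_change q s q
  = 'D_(delta_mx 0 i) (transition (chart_at p) (chart_at s)) (ephi p q).
Proof.
move=> pq sq; rewrite /coord_field /tangent_change -mulmxA jacobian_cocycle //;
  try exact: chart_at_atlas; last exact: chart_at_dom.
by rewrite transition_jacobian //; apply: chart_at_atlas.
Qed.

(** The components are row i of the Jacobian of the transition map; writing them
    as a composition exposes them to the chain rule and to
    [smooth_near_comp]. *)
Lemma coord_field_in_chart p s i q : dom p q -> dom s q ->
  {near ephi s q, vfield_in_chart s (coord_field p i) =1
    'D_(delta_mx 0 i) (transition (chart_at p) (chart_at s))
       \o transition (chart_at s) (chart_at p)}.
Proof.
move=> pq sq.
have py := near_chart_inv sq (near_chart_dom pq).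
have sy := near_chart_inv sq (near_chart_dom sq).
apply: filterS2 py sy => y py sy.
by rewrite /vfield_in_chart /= coord_field_change.
Qed.

(** The chart selected at q is in general not the one that defines the field, so
    its components there involve the transition maps in both directions. *)
Lemma coord_field_smooth p i q : dom p q -> smooth_vfield_at q (coord_field p i).
Proof.
move=> pq; have qq := chart_at_dom q.
have ap := chart_at_atlas p; have aq := chart_at_atlas q.
rewrite /smooth_vfield_at.
apply: (@smooth_near_eq _ _ _ ('D_(delta_mx 0 i) (transition (chart_at p) (chart_at q))
       \o transition (chart_at q) (chart_at p))).
  by near do apply/esym; apply: coord_field_in_chart.
apply: smooth_near_comp; first exact: transition_smooth.
by rewrite transitionE //; apply/smooth_near_derive/transition_smooth.
Unshelve. all: by end_near. Qed.

(** With t the transition map from the chart at p to the chart at q, d_j reads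
    (D_j t) o t^-1 in the latter; as d_i reads e_i in the former, the chain
    rule leaves a second derivative of t. *)
Lemma derive_coord_field_in_chart p i j q : dom p q ->
  'D_(coord_field p i q) (vfield_in_chart q (coord_field p j)) (ephi q q)
  = 'D_(delta_mx 0 i) ('D_(delta_mx 0 j) (transition (chart_at p) (chart_at q)))
      (ephi p q).
Proof.
move=> pq; have qq := chart_at_dom q.
have ap := chart_at_atlas p; have aq := chart_at_atlas q.
have Ev : 'D_(coord_field p i q) (transition (chart_at q) (chart_at p)) (ephi q q)
    = delta_mx 0 i.
  rewrite -(transition_jacobian _ aq ap qq pq) /coord_field /tangent_change.
  rewrite -mulmxA (jacobian_cocycle ap aq ap pq qq pq).
  by rewrite (jacobian_transition_id ap pq) mulmx1.
rewrite (near_eq_derive _ (coord_field_in_chart j pq qq)).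
rewrite derive_comp; first last.
- rewrite transitionE //.
  exact/smooth_near_differentiable/smooth_near_derive/transition_smooth.
- exact/smooth_near_differentiable/transition_smooth.
by rewrite Ev transitionE.
Qed.

Lemma lie_bracket_coord_field p i j q : dom p q ->
  lie_bracket (coord_field p i) (coord_field p j) q = 0.
Proof.
move=> pq; rewrite /lie_bracket !derive_coord_field_in_chart //.
apply/eqP; rewrite subr_eq0; apply/eqP; apply: derive_comm_rV.
by apply: transition_smooth => //; [exact: chart_at_atlas|exact: chart_at_atlas
  |exact: chart_at_dom].
Qed.

Lemma dact_coord_field p i (f : M -> R) q : dom p q -> smooth_fun_at q f ->
  dact (coord_field p i) f q
  = 'D_(delta_mx 0 i) (fun_in_chart p f) (ephi p q).
Proof.
move=> pq sf; have qq := chart_at_dom q.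
have ap := chart_at_atlas p; have aq := chart_at_atlas q.
have st := transition_smooth ap aq pq qq.
rewrite (near_eq_derive _ (near_transition_comp f pq qq)).
rewrite derive_comp; first last.
- by rewrite transitionE //; apply: smooth_near_differentiable.
- exact: smooth_near_differentiable.
by rewrite -(transition_jacobian _ ap aq pq qq) transitionE.
Qed.

End Atlas.

(** * Vanishing trace of skew endomorphisms *)

(** From K = - g K^T g^-1 follows tr K = - tr K. *)
Lemma trace_skew (F : numFieldType) n (g K : 'M[F]_n) :
  g \in unitmx -> K *m g + g *m K^T = 0 -> \tr K = 0.
Proof.
move=> gU /eqP; rewrite addr_eq0 => /eqP Kg.
have KE : K = - (g *m K^T *m invmx g) by rewrite -mulNmx -Kg mulmxK.
have : \tr K = - \tr K.
  by rewrite {1}KE raddfN /= mxtrace_mulC mulKmx // mxtrace_tr.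
by move/eqP; rewrite -subr_eq0 opprK -mulr2n mulrn_eq0 => /eqP.
Qed.

(** * Local nature of derivatives and connections *)

Section LocalFields.
Context (R : realType) (n : nat) (M : smoothManifold R n).
Implicit Types (p q : M) (f h : M -> R) (X Y W : vfield M).

Lemma near_fun_in_chart p f h : {near p, f =1 h} ->
  {near chart_map (chart_at p) p, fun_in_chart p f =1 fun_in_chart p h}.
Proof. exact: near_chart_inv (chart_at_dom p). Qed.

Lemma smooth_fun_at_near p f h :
  {near p, f =1 h} -> smooth_fun_at p f -> smooth_fun_at p h.
Proof. by move=> /near_fun_in_chart; apply: smooth_near_eq. Qed.

Lemma smooth_fun_at_cst p (c : R) : smooth_fun_at p (fun=> c).
Proof. exact: smooth_near_cst. Qed.

Lemma dact_near X p f h : {near p, f =1 h} -> dact X f p = dact X h p.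
Proof. by move=> /near_fun_in_chart; apply: near_eq_derive. Qed.

Lemma dact_cst X (c : R) p : dact X (fun=> c) p = 0.
Proof. exact: derive_cst. Qed.

Lemma dactD X f h p : smooth_fun_at p f -> smooth_fun_at p h ->
  dact X (f \+ h) p = dact X f p + dact X h p.
Proof.
move=> sf sh; apply: deriveD;
  exact/diff_derivable/smooth_near_differentiable.
Qed.

Lemma smooth_vfield_at_near p X Y :
  {near p, X =1 Y} -> smooth_vfield_at p X -> smooth_vfield_at p Y.
Proof.
move=> /(near_chart_inv (chart_at_dom p)) XY; apply: smooth_near_eq.
by apply: filterS XY => y; rewrite /vfield_in_chart /= => ->.
Qed.

Lemma smooth_vfield_at0 p : smooth_vfield_at p (fun=> 0).
Proof.
rewrite /smooth_vfield_at /vfield_in_chart.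
rewrite (_ : _ \o _ = cst 0); first exact: smooth_near_cst.
by apply/funext => y; rewrite /= mul0mx.
Qed.

(** Near p both actions are partial derivatives of f read in the chart at p,
    where second derivatives are symmetric. *)
Lemma dact_coord_comm p i j f : (\forall q \near p, smooth_fun_at q f) ->
  dact (coord_field p i) (dact (coord_field p j) f) p
  = dact (coord_field p j) (dact (coord_field p i) f) p.
Proof.
move=> sf; have pp := chart_at_dom p.
have D2 a b : dact (coord_field p a) (dact (coord_field p b) f) p =
   'D_(delta_mx 0 a) ('D_(delta_mx 0 b) (fun_in_chart p f))
     (chart_map (chart_at p) p).
  rewrite {1}/dact coord_fieldE; apply: near_eq_derive.
  have h1 := near_chart_inv pp sf.
  have h2 := near_chart_inv pp (near_chart_dom pp).
  apply: filterS3 h1 h2 (near_chart_invK pp) => y s1 s2 s3.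
  by rewrite /fun_in_chart /= dact_coord_field // s3.
have E := derive_comm (delta_mx 0 i) (delta_mx 0 j) (nbhs_singleton sf).
exact (etrans (D2 i j) (etrans E (esym (D2 j i)))).
Qed.

Section Locality.
Context (nabla : vfield M -> vfield M -> vfield M).
Context (hn : affine_connection nabla).

(** The indicator of the set where the two fields agree plays the part of a bump
    function: it is smooth at p, being constant near p, and multiplying the two
    fields by it makes them equal everywhere. *)
Lemma nabla_near_r p X Y Y' : smooth_vfield_at p X -> smooth_vfield_at p Y ->
  {near p, Y =1 Y'} -> nabla X Y p = nabla X Y' p.
Proof.
move=> sX sY YY'; have sY' := smooth_vfield_at_near YY' sY.
pose f q : R := `[< Y q = Y' q >]%:R.
have f1 : {near p, f =1 (fun=> 1)} by apply: filterS YY' => q E; rewrite /f asboolT.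
have sf : smooth_fun_at p f.
  by apply: smooth_fun_at_near (smooth_fun_at_cst p 1); apply: filterS f1.
have fE : (fun q => f q *: Y q) = (fun q => f q *: Y' q).
  by apply/funext => q; rewrite /f; case: asboolP => [->|_]; rewrite ?scale0r.
have H Y0 : smooth_vfield_at p Y0 -> nabla X (fun q => f q *: Y0 q) p = nabla X Y0 p.
  move=> s0; rewrite (nabla_leibniz hn) // (dact_near _ f1) dact_cst.
  by rewrite (nbhs_singleton f1) scale0r scale1r add0r.
by rewrite -(H Y) // -(H Y') // fE.
Qed.

Lemma nabla_near_l p X X' Y : smooth_vfield_at p X -> smooth_vfield_at p Y ->
  {near p, X =1 X'} -> nabla X Y p = nabla X' Y p.
Proof.
move=> sX sY XX'; have sX' := smooth_vfield_at_near XX' sX.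
pose f q : R := `[< X q = X' q >]%:R.
have f1 : {near p, f =1 (fun=> 1)} by apply: filterS XX' => q E; rewrite /f asboolT.
have sf : smooth_fun_at p f.
  by apply: smooth_fun_at_near (smooth_fun_at_cst p 1); apply: filterS f1.
have fE : (fun q => f q *: X q) = (fun q => f q *: X' q).
  by apply/funext => q; rewrite /f; case: asboolP => [->|_]; rewrite ?scale0r.
have H X0 : smooth_vfield_at p X0 -> nabla (fun q => f q *: X0 q) Y p = nabla X0 Y p.
  by move=> s0; rewrite (nablaZl hn) // (nbhs_singleton f1) scale1r.
by rewrite -(H X) // -(H X') // fE.
Qed.

Lemma nabla0l p Y : smooth_vfield_at p Y -> nabla (fun=> 0) Y p = 0.
Proof.
move=> sY.
have := nablaZl hn (smooth_fun_at_cst p 0) (smooth_vfield_at0 p) sY.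
move=> H; rewrite -[RHS](scale0r (nabla (fun=> 0) Y p)) -H.
by congr (nabla _ _ _); apply/funext => q; rewrite scale0r.
Qed.

End Locality.

End LocalFields.

(** * Curvature of a Levi-Civita connection in coordinates *)

Lemma app2Bl (R : realType) n (M : smoothManifold R n) (T : tensor2 M)
    (U V V' W : vfield M) q :
  U q = V q - V' q -> app2 T U W q = app2 T V W q - app2 T V' W q.
Proof. by move=> UE; rewrite /app2 UE !mulmxBl mxE [in X in _ + X]mxE. Qed.

Lemma app2Br (R : realType) n (M : smoothManifold R n) (T : tensor2 M)
    (U V V' W : vfield M) q :
  U q = V q - V' q -> app2 T W U q = app2 T W V q - app2 T W V' q.
Proof. by move=> UE; rewrite /app2 UE linearB mulmxBr mxE [in X in _ + X]mxE. Qed.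

Section Ricci.
Context (R : realType) (n : nat) (M : smoothManifold R n).
Context (g : tensor2 M) (hg : semi_riemannian g).
Context (nabla : vfield M -> vfield M -> vfield M) (hn : levi_civita g nabla).
Context (p : M).

Let hc := lc_connection hn.
Let X := coord_field p.
Let dom q := chart_dom (chart_at p) q.

Let sX i q : dom q -> smooth_vfield_at q (X i).
Proof. exact: coord_field_smooth. Qed.

Let pp : dom p. Proof. exact: chart_at_dom. Qed.

Let sXp i : smooth_vfield_at p (X i). Proof. exact: sX. Qed.

Let sN i j : smooth_vfield_at p (nabla (X i) (X j)).
Proof. exact: nabla_smooth. Qed.

Lemma nabla_coord_sym i j q : dom q -> nabla (X i) (X j) q = nabla (X j) (X i) q.
Proof.
move=> pq; apply/eqP; rewrite -subr_eq0 (lc_torsion_free hn); try exact: sX.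
by rewrite lie_bracket_coord_field.
Qed.

Lemma curvature_coordE i j k : curvature nabla (X i) (X j) (X k) p =
  nabla (X i) (nabla (X j) (X k)) p - nabla (X j) (nabla (X i) (X k)) p.
Proof.
rewrite /curvature.
have b0 : {near p, (fun=> 0) =1 lie_bracket (X i) (X j)}.
  by apply: filterS (near_chart_dom pp) => q pq; rewrite lie_bracket_coord_field.
rewrite -(nabla_near_l hc _ _ b0) //; last exact: smooth_vfield_at0.
by rewrite nabla0l // subr0.
Qed.

Lemma curvature_anti i j k :
  curvature nabla (X i) (X j) (X k) p = - curvature nabla (X j) (X i) (X k) p.
Proof. by rewrite !curvature_coordE opprB. Qed.

(** Torsion-freeness on a neighbourhood of p exchanges the two inner fields of
    a second covariant derivative at p, after which the six terms cancel. *)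
Lemma first_bianchi i j k :
  curvature nabla (X i) (X j) (X k) p + curvature nabla (X j) (X k) (X i) p
  + curvature nabla (X k) (X i) (X j) p = 0.
Proof.
have S a b c : nabla (X a) (nabla (X b) (X c)) p = nabla (X a) (nabla (X c) (X b)) p.
  apply: nabla_near_r => //.
  by apply: filterS (near_chart_dom pp) => q pq; apply: nabla_coord_sym.
rewrite !curvature_coordE (S i k j) (S j i k) (S k j i).
move: (nabla _ _ p) => a; move: (nabla _ _ p) => b; move: (nabla _ _ p) => c.
by rewrite !subrKA subrr.
Qed.

(** The commutator of d_i and d_j kills the function g(d_k, d_l); expanding it
    with metricity, the products of first covariant derivatives cancel and the
    curvature terms remain. *)
Lemma curvature_skew i j k l :
  app2 g (curvature nabla (X i) (X j) (X k)) (X l) p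
  + app2 g (X k) (curvature nabla (X i) (X j) (X l)) p = 0.
Proof.
pose f := app2 g (X k) (X l).
have sf : \forall q \near p, smooth_fun_at q f.
  by apply: filterS (near_chart_dom pp) => q pq; apply: (sr_smooth hg); apply: sX.
pose a r := app2 g (nabla (X r) (X k)) (X l) \+ app2 g (X k) (nabla (X r) (X l)).
have fa r : {near p, dact (X r) f =1 a r}.
  by apply: filterS (near_chart_dom pp) => q pq; apply: (lc_metric hn); apply: sX.
have E s r : dact (X s) (dact (X r) f) p =
    app2 g (nabla (X s) (nabla (X r) (X k))) (X l) p
    + app2 g (nabla (X r) (X k)) (nabla (X s) (X l)) p
    + (app2 g (nabla (X s) (X k)) (nabla (X r) (X l)) p
    + app2 g (X k) (nabla (X s) (nabla (X r) (X l))) p).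
  rewrite (dact_near _ (fa r)) dactD; try exact: (sr_smooth hg).
  by rewrite !(lc_metric hn).
rewrite (app2Bl _ _ (curvature_coordE i j k)) (app2Br _ _ (curvature_coordE i j l)).
have alg (a1 b1 c1 d1 e1 f1 : R) :
  a1 + b1 + (c1 + d1) = e1 + c1 + (b1 + f1) -> a1 - e1 + (d1 - f1) = 0 by lra.
have C := dact_coord_comm i j sf.
exact (alg _ _ _ _ _ _ (etrans (esym (E i j)) (etrans C (E j i)))).
Qed.

Lemma ricci_sym : (ricci nabla p)^T = ricci nabla p.
Proof.
apply/matrixP => k j; rewrite !mxE.
pose K a b := \matrix_(i < n) curvature nabla (X i) (X a) (X b) p.
pose L := \matrix_(i < n) curvature nabla (X j) (X k) (X i) p.
have KL : K j k - K k j = - L.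
  apply/row_matrixP => i; rewrite raddfB raddfN /= !rowK.
  rewrite (curvature_anti i k j) opprK; apply/eqP; rewrite -addr_eq0 addrAC.
  by rewrite first_bianchi.
have gU : g p \in unitmx.
  rewrite -row_free_unit -kermx_eq0; apply/rowV0P => u /sub_kermxP ug.
  by apply: (sr_nondegenerate hg (p := p)) => v; rewrite ug mul0mx mxE.
have L0 : \tr L = 0.
  apply: (trace_skew gU); apply/matrixP => i l; rewrite [LHS]mxE [RHS]mxE.
  have Xp a : X a p = delta_mx 0 a := coord_fieldE p a.
  have rL m : curvature nabla (X j) (X k) (X m) p = row m L by rewrite rowK.
  rewrite -(curvature_skew j k i l) /app2 !Xp !rL; congr (_ + _).
    by rewrite trmx_delta -colE [RHS]mxE -row_mul [RHS]mxE.
  by rewrite -rowE tr_row !mxE; apply: eq_bigr => m _; rewrite !mxE.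
apply/eqP; rewrite -subr_eq0; have := congr1 mxtrace KL.
by rewrite raddfB raddfN /= L0 oppr0 => ->.
Qed.

End Ricci.

(** * Cyclic averaging *)

Section SymmetricTensors.
Context (R : realType) (n : nat) (M : smoothManifold R n).
Context (T : tensor2 M) (Tsym : forall p, (T p)^T = T p).

Lemma app2_sym X Y : app2 T X Y = app2 T Y X.
Proof.
apply/funext => p; rewrite /app2.
have -> : X p *m T p *m (Y p)^T = (Y p *m T p *m (X p)^T)^T.
  by rewrite !trmx_mul trmxK Tsym mulmxA.
by rewrite mxE.
Qed.

Lemma nabla_tensor2_sym nabla X Y W p :
  nabla_tensor2 nabla T X Y W p = nabla_tensor2 nabla T X W Y p.
Proof.
rewrite /nabla_tensor2 (app2_sym Y W) (app2_sym (nabla X Y) W).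
by rewrite (app2_sym Y (nabla X W)) addrAC.
Qed.

End SymmetricTensors.

Lemma Ztensor_sym (R : realType) n (M : smoothManifold R n) (g : tensor2 M)
    (nabla : vfield M -> vfield M -> vfield M) (phi : M -> R) p :
  semi_riemannian g -> levi_civita g nabla ->
  (Ztensor g nabla phi p)^T = Ztensor g nabla phi p.
Proof.
move=> hg hn; rewrite /Ztensor linearD linearZ /= (sr_sym hg).
by rewrite (ricci_sym hg hn).
Qed.

Theorem proposition2p1 (R : realType) (n : nat) (hn : (3 <= n)%N)
  (M : smoothManifold R n) (hM : connected [set: M])
  (g : tensor2 M) (hg : semi_riemannian g)
  (nabla : vfield M -> vfield M -> vfield M) (hnabla : levi_civita g nabla)
  (phi : M -> R) (hphi : smooth_fun phi)
  (A B D : form1 M)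
  (hA : smooth_form1 A) (hB : smooth_form1 B) (hD : smooth_form1 D) :
  let Z : tensor2 M := Ztensor g nabla phi in
  let E : form1 M := fun p => 3^-1 *: (A p + B p + D p) in
  (forall X X1 X2 : vfield M,
     smooth_vfield X -> smooth_vfield X1 -> smooth_vfield X2 ->
     forall p : M,
       nabla_tensor2 nabla Z X X1 X2 p + nabla_tensor2 nabla Z X1 X X2 p
         + nabla_tensor2 nabla Z X2 X1 X p
       = app1 A X p * app2 Z X1 X2 p + app1 B X1 p * app2 Z X X2 p
         + app1 D X2 p * app2 Z X1 X p) ->
  forall X X1 X2 : vfield M,
    smooth_vfield X -> smooth_vfield X1 -> smooth_vfield X2 ->
    forall p : M,
      nabla_tensor2 nabla Z X X1 X2 p + nabla_tensor2 nabla Z X1 X X2 p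
        + nabla_tensor2 nabla Z X2 X1 X p
      = app1 E X p * app2 Z X1 X2 p + app1 E X1 p * app2 Z X X2 p
        + app1 E X2 p * app2 Z X1 X p.
Proof.
move=> Z E H X X1 X2 sX sX1 sX2 p.
have Zsym q : (Z q)^T = Z q by apply: Ztensor_sym.
have EE Y : app1 E Y p = 3^-1 * (app1 A Y p + app1 B Y p + app1 D Y p).
  by rewrite /app1 -scalemxAr !mulmxDr [LHS]mxE !(mxE, addrA) mulrDr.
have H1 := H X X1 X2 sX sX1 sX2 p.
have H2 := H X1 X2 X sX1 sX2 sX p.
have H3 := H X2 X X1 sX2 sX sX1 p.
move: H2 H3.
rewrite (nabla_tensor2_sym Zsym nabla X1 X2 X) (nabla_tensor2_sym Zsym nabla X X2 X1).
rewrite (nabla_tensor2_sym Zsym nabla X2 X X1).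
rewrite (app2_sym Zsym X2 X) (app2_sym Zsym X2 X1).
rewrite (app2_sym Zsym X1 X) in H1 *; rewrite !EE => H2 H3.
have average (u v w a a1 a2 b b1 b2 d d1 d2 z z1 z2 : R) :
    u + v + w = a * z + b1 * z1 + d2 * z2 ->
    v + w + u = a1 * z1 + b2 * z2 + d * z ->
    w + u + v = a2 * z2 + b * z + d1 * z1 ->
    u + v + w = 3^-1 * (a + b + d) * z + 3^-1 * (a1 + b1 + d1) * z1
      + 3^-1 * (a2 + b2 + d2) * z2 by lra.
exact (average _ _ _ _ _ _ _ _ _ _ _ _ _ _ _ H1 H2 H3).
Qed.
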